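(* Let $\mathbb{A}$ be an algebra, $n\ge 2$, and $(\theta_0,\dots,\theta_{n-1})\in\mathrm{Con}(\mathbb{A})^n$. Then for every permutation $\sigma$ of $\{0,\dots,n-1\}$, $$[\theta_0,\dots,\theta_{n-1}]_H=[\theta_{\sigma(0)},\dots,\theta_{\sigma(n-1)}]_H.$$
   Context: Identify $n$ with $\{0,\dots,n-1\}$; $2^n$ is the set of functions $f:n\to\{0,1\}$, and for $\gamma\in A^{2^n}$ write $\gamma_f$ for its value at $f$. For $i\in n$, $\epsilon\in\{0,1\}$, $\mathrm{Faces}_i^\epsilon(\gamma)\in A^{2^{n\setminus\{i\}}}$ is $g\mapsto\gamma_{g\cup\{(i,\epsilon)\}}$; for $R\subseteq A^{2^n}$, $\mathrm{Faces}_i(R)=\{\langle\mathrm{Faces}_i^0(\gamma),\mathrm{Faces}_i^1(\gamma)\rangle:\gamma\in R\}$. A binary relation $E$ is quasireflexive if $\langle a,b\rangle\in E$ implies $\langle a,a\rangle,\langle b,b\rangle\in E$. An $n$-dimensional congruence of $\mathbb{A}$ is a subset $R\subseteq A^{2^n}$ compatible with the basic operations of $\mathbb{A}$ such that each $\mathrm{Faces}_i(R)$, $i\in n$, is quasireflexive, symmetric and transitive. $\mathrm{cube}_i(x,y)\in A^{2^n}$ has value $x$ at $f$ if $f_i=0$ and $y$ if $f_i=1$. $\Delta(\theta_0,\dots,\theta_{n-1})$ is the least $n$-dimensional congruence of $\mathbb{A}$ containing $\bigcup_{i\in n}\{\mathrm{cube}_i(x,y):\langle x,y\rangle\in\theta_i\}$.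 For $i\in n$, $g\in 2^{n\setminus\{i\}}$, the $(i)$-cross-section line of $\gamma$ at $g$ is $\langle\gamma_{g\cup\{(i,0)\}},\gamma_{g\cup\{(i,1)\}}\rangle$. For $\delta\in\mathrm{Con}(\mathbb{A})$, $R\subseteq A^{2^n}$ has $(\delta,i)$-centrality if there is no $\gamma\in R$ for which exactly $2^{n-1}-1$ of its $2^{n-1}$ $(i)$-cross-section lines belong to $\delta$. The hypercommutator is $[\theta_0,\dots,\theta_{n-1}]_{H}=\bigwedge\{\delta\in\mathrm{Con}(\mathbb{A}):\Delta(\theta_0,\dots,\theta_{n-1})\text{ has }(\delta,n-1)\text{-centrality}\}$. *)

(* Defs.v *)
From Stdlib Require Export RelationClasses.
From mathcomp Require Export all_boot perm.
From mathcomp Require Export boolp classical_sets.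

Set Implicit Arguments.
Unset Strict Implicit.
Unset Printing Implicit Defensive.

Local Open Scope classical_set_scope.

Record algebra := Algebra {
  carrier :> Type;
  symbol : Type;
  arity : symbol -> nat;
  op : forall s : symbol, ('I_(arity s) -> carrier) -> carrier
}.

Definition congruence (A : algebra) (theta : A -> A -> Prop) : Prop :=
  Equivalence theta /\
  forall (s : symbol A) (x y : 'I_(arity s) -> A),
    (forall k, theta (x k) (y k)) -> theta (op x) (op y).

Definition quasireflexive (T : Type) (E : T -> T -> Prop) : Prop :=
  forall a b, E a b -> E a a /\ E b b.

(* T^(2^S): cubes with vertices labelled by T, for a finite set S of
   coordinates; the digits 0 and 1 are [false] and [true]. *)
Definition cube (S : finType) (T : Type) : Type := {ffun S -> bool} -> T.

(* The coordinates S \ {i}; [extend g e] below is g \cup {(i, e)}. *)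
Definition others (S : finType) (i : S) : finType := {j : S | j != i}.

Definition extend (S : finType) (i : S) (g : {ffun others i -> bool})
    (e : bool) : {ffun S -> bool} :=
  [ffun j => if insub j is Some k then g k else e].

Definition face (S : finType) (T : Type) (i : S) (e : bool)
    (gamma : cube S T) : cube (others i) T :=
  fun g => gamma (extend g e).
Arguments face [S T] i e gamma g.

Definition faces (S : finType) (T : Type) (i : S) (R : set (cube S T))
    (a b : cube (others i) T) : Prop :=
  exists2 gamma, R gamma & a = face i false gamma /\ b = face i true gamma.
Arguments faces [S T] i R a b.

Definition compatible (A : algebra) (S : finType) (R : set (cube S A)) : Prop :=
  forall (s : symbol A) (gamma : 'I_(arity s) -> cube S A),
    (forall k, R (gamma k)) -> R (fun f => op (fun k => gamma k f)).

Definition hdcongruence (A : algebra) (n : nat) (R : set (cube 'I_n A)) : Prop :=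
  compatible R /\
  forall i : 'I_n,
    [/\ quasireflexive (faces i R), Symmetric (faces i R)
      & Transitive (faces i R)].

Definition cube_at (T : Type) (n : nat) (i : 'I_n) (x y : T) : cube 'I_n T :=
  fun f => if f i then y else x.

Definition Delta (A : algebra) (n : nat) (theta : 'I_n -> A -> A -> Prop) :
    set (cube 'I_n A) :=
  smallest (@hdcongruence A n)
    [set gamma | exists i x y, theta i x y /\ gamma = cube_at i x y].

Lemma extend_at (S : finType) (i : S) (g : {ffun others i -> bool}) (e : bool) :
  extend g e i = e.
Proof. by rewrite ffunE; case: insubP => [k|//]; rewrite eqxx. Qed.

Lemma extendK (S : finType) (i : S) (g : {ffun others i -> bool}) (e : bool) :
  [ffun j : others i => extend g e (val j)] = g.
Proof. by apply/ffunP => j; rewrite !ffunE valK. Qed.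

Lemma extend_surj (S : finType) (i : S) (f : {ffun S -> bool}) :
  extend [ffun j : others i => f (val j)] (f i) = f.
Proof.
apply/ffunP => j; rewrite ffunE; case: insubP => [k _ <-|]; first by rewrite ffunE.
by rewrite negbK => /eqP ->.
Qed.

Lemma face_inj (S : finType) (T : Type) (i : S) (c d : cube S T) :
  face i false c = face i false d -> face i true c = face i true d -> c = d.
Proof.
move=> h0 h1; apply/funext => f; rewrite -(extend_surj i f).
by case: (f i); [exact: (congr1 (@^~ _) h1) | exact: (congr1 (@^~ _) h0)].
Qed.

Lemma faces_setT (S : finType) (T : Type) (i : S) (a b : cube (others i) T) :
  faces i setT a b.
Proof.
exists (fun f : {ffun S -> bool} =>
  (if f i then b else a) [ffun j : others i => f (val j)]) => //.
by split; apply/funext => g; rewrite /face extend_at extendK.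
Qed.

Lemma faces_smallest (S : finType) (T : Type) (i : S)
    (P : set (cube S T) -> Prop) (G : set (cube S T)) (a b : cube (others i) T) :
  faces i (smallest P G) a b <-> (forall R, P R -> G `<=` R -> faces i R a b).
Proof.
split=> [[c Sc ab] R PR GR|h]; first by exists c => //; apply: Sc.
have [c _ [ac bc]] := faces_setT a b.
exists c => // R /= [PR GR]; have [d Rd [ad bd]] := h R PR GR.
by rewrite (@face_inj _ _ i c d) // -?ac -?bc.
Qed.

(* [smallest] is an intersection: this makes [Delta theta] the least higher
   dimensional congruence containing its generators. *)
Lemma hdcongruence_Delta (A : algebra) (n : nat)
    (theta : 'I_n -> A -> A -> Prop) : hdcongruence (Delta theta).
Proof.
split=> [s c hc R RG|i].
  by apply: (proj1 (proj1 RG)) => k; apply: hc.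
split.
- move=> a b /faces_smallest h; split; apply/faces_smallest => R PR GR;
  by have [q _ _] := proj2 PR i; have [] := q _ _ (h R PR GR).
- move=> a b /faces_smallest h; apply/faces_smallest => R PR GR.
  by have [_ q _] := proj2 PR i; apply: q; apply: h.
- move=> a b c /faces_smallest h /faces_smallest k.
  apply/faces_smallest => R PR GR.
  by have [_ _ q] := proj2 PR i; apply: q (h R PR GR) (k R PR GR).
Qed.

(* R has (delta, i)-centrality; [(face i false gamma g, face i true gamma g)]
   is the (i)-cross-section line of gamma at g. *)
Definition centrality (T : Type) (n : nat) (delta : T -> T -> Prop) (i : 'I_n)
    (R : set (cube 'I_n T)) : Prop :=
  ~ exists2 gamma, R gamma &
      #|[set g : {ffun others i -> bool} |
          `[< delta (face i false gamma g) (face i true gamma g) >]]%SET|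
      = (2 ^ n.-1 - 1)%N.

(* The dimension is n.+1, so that the last coordinate is [ord_max]. The meet
   in Con(A) is the intersection. *)
Definition hypercommutator (A : algebra) (n : nat)
    (theta : 'I_n.+1 -> A -> A -> Prop) : A -> A -> Prop :=
  fun x y => forall delta : A -> A -> Prop,
    congruence delta -> centrality delta ord_max (Delta theta) -> delta x y.

Lemma congruence_hypercommutator (A : algebra) (n : nat)
    (theta : 'I_n.+1 -> A -> A -> Prop) : congruence (hypercommutator theta).
Proof.
split; first split.
- by move=> x delta [[r _ _] _] _; apply: r.
- by move=> x y h delta dc dz; have [[_ s _] _] := dc; apply: s; apply: h.
- move=> x y z h k delta dc dz; have [[_ _ t] _] := dc.
  by apply: t (h _ dc dz) (k _ dc dz).
- by move=> s x y h delta dc dz; apply: (proj2 dc) => k; apply: h.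
Qed.

(* Main.v *)
(** Write [R] for [Delta theta] and let [H] be the set of pairs [(x, y)] such
    that the cube equal to [x] everywhere except for [y] at one corner lies in
    [R]. Transitivity of the face relations lets one collapse a cube of [R]
    onto any of its vertices without affecting whether a change of that vertex
    stays in [R]; hence changing a value [x] of a cube of [R] to [y] gives a
    cube of [R] exactly when [(x, y)] is in [H]. It follows that [H] is a
    congruence for which [R] is central in every direction, so that [H] is the
    hypercommutator. The definition of [H] does not refer to any order of the
    coordinates. *)
Require Import Defs.

Set Implicit Arguments.
Unset Strict Implicit.
Unset Printing Implicit Defensive.

Local Open Scope classical_set_scope.

(** * Cubes, their faces, and closure in terms of operations on cubes *)

Section Cubes.
Variables (T : Type) (n : nat).
Implicit Types (f : {ffun 'I_n -> bool}) (c d : cube 'I_n T) (i : 'I_n).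

Definition set_coord f i (e : bool) : {ffun 'I_n -> bool} :=
  [ffun j => if j == i then e else f j].

Definition collapse i (e : bool) c : cube 'I_n T := fun f => c (set_coord f i e).

Definition reflect_cube i c : cube 'I_n T := fun f => c (set_coord f i (~~ f i)).

Definition glue i c d : cube 'I_n T := fun f => if f i then d f else c f.

Definition set_vertex c f (y : T) : cube 'I_n T :=
  fun g => if g == f then y else c g.

Lemma set_coord_extend i (g : {ffun others i -> bool}) e e' :
  set_coord (extend g e) i e' = extend g e'.
Proof.
apply/ffunP => j; rewrite !ffunE; case: insubP => [k /negbTE-> //|].
by rewrite negbK => ->.
Qed.

Lemma face_collapse i e e' c : face i e (collapse i e' c) = face i e' c.
Proof. by apply/funext => g; rewrite /face /collapse set_coord_extend. Qed.

Lemma face_reflect i e c : face i e (reflect_cube i c) = face i (~~ e) c.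
Proof.
by apply/funext => g; rewrite /face /reflect_cube extend_at set_coord_extend.
Qed.

Lemma face_glue i e c d : face i e (glue i c d) = face i e (if e then d else c).
Proof. by apply/funext => g; rewrite /face /glue extend_at; case: e. Qed.

Lemma face_inj_opp i e c d :
  face i e c = face i e d -> face i (~~ e) c = face i (~~ e) d -> c = d.
Proof. by case: e => [h1 h0|h0 h1]; apply: (@face_inj _ _ i). Qed.

Definition face_closed (R : set (cube 'I_n T)) : Prop :=
  forall i, [/\ forall e c, R c -> R (collapse i e c),
                forall c, R c -> R (reflect_cube i c)
              & forall c d, R c -> R d -> face i true c = face i false d ->
                  R (glue i c d)].

(** A cube is determined by two opposite faces, so the witness supplied by quasireflexivity,
    symmetry or transitivity can only be the collapsed, reflected or glued cube. *)
Lemma face_closedP (R : set (cube 'I_n T)) :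
  (forall i, [/\ quasireflexive (faces i R), Symmetric (faces i R)
               & Transitive (faces i R)]) <-> face_closed R.
Proof.
split=> h i; have [q s t] := h i; split.
- move=> e c Rc.
  have [] := q (face i false c) (face i true c) (ex_intro2 _ _ c Rc (conj erefl erefl)).
  move=> [d Rd [d0 d1]] [d' Rd' [d0' d1']].
  case: e; [have -> : collapse i true c = d' | have -> : collapse i false c = d];
    by [| apply: (@face_inj _ _ i); rewrite face_collapse].
- move=> c Rc; have [d Rd [d0 d1]] := s (face i false c) (face i true c)
    (ex_intro2 _ _ c Rc (conj erefl erefl)).
  by have -> : reflect_cube i c = d by apply: (@face_inj _ _ i); rewrite face_reflect.
- move=> c d Rc Rd cd.
  have [k Rk [k0 k1]] := t (face i false c) (face i true c) (face i true d)
    (ex_intro2 _ _ c Rc (conj erefl erefl)) (ex_intro2 _ _ d Rd (conj cd erefl)).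
  by have -> : glue i c d = k by apply: (@face_inj _ _ i); rewrite face_glue.
- move=> a b [c Rc [-> ->]]; split.
    by exists (collapse i false c); [exact: q | rewrite !face_collapse].
  by exists (collapse i true c); [exact: q | rewrite !face_collapse].
- move=> a b [c Rc [-> ->]].
  by exists (reflect_cube i c); [exact: s | rewrite !face_reflect].
- move=> a b k [c Rc [-> cb]] [d Rd [db ->]].
  by exists (glue i c d); [apply: t; rewrite // -cb | rewrite !face_glue].
Qed.

Definition zero_vertex : {ffun 'I_n -> bool} := [ffun=> false].

(** This is [H] of the overview with the corner fixed at [zero_vertex]; for face-closed [R] the
    choice of corner is immaterial by [corner_rel_vertex]. *)
Definition corner_rel (R : set (cube 'I_n T)) (x y : T) : Prop :=
  R (set_vertex (fun=> x) zero_vertex y).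

(** * Changing vertices of cubes in a face-closed set *)

Section FaceClosed.
Variable R : set (cube 'I_n T).
Hypothesis Rf : face_closed R.

(* The [i]-faces of the two cubes are [m, b] and [m, a] with [a, b] the faces of
   [c], which are related to each other. *)
Lemma set_vertex_collapse i c f y : R c ->
  R (set_vertex (collapse i (f i) c) f y) <-> R (set_vertex c f y).
Proof.
move=> Rc; have [cl rf gl] := Rf i.
(* Transitivity, read from the [e]-face to the opposite one. *)
have cross e d1 d2 : R d1 -> R d2 -> face i (~~ e) d1 = face i e d2 ->
    exists2 d, R d & face i e d = face i e d1 /\ face i (~~ e) d = face i (~~ e) d2.
  case: e => /= R1 R2 h.
    by exists (glue i d2 d1); [apply: gl | rewrite !face_glue].
  by exists (glue i d1 d2); [apply: gl | rewrite !face_glue].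
have far d : face i (~~ f i) (set_vertex d f y) = face i (~~ f i) d.
  apply/funext => g; rewrite /face /set_vertex; case: eqP => // fE.
  by have := congr1 (fun h : {ffun _} => h i) fE; rewrite extend_at; case: (f i).
have near : face i (f i) (set_vertex (collapse i (f i) c) f y)
    = face i (f i) (set_vertex c f y).
  by apply/funext => g; rewrite /face /set_vertex /collapse set_coord_extend.
split=> h.
- have [|d Rd [d0 d1]] := cross (f i) _ _ h Rc; first by rewrite far face_collapse.
  suff -> : set_vertex c f y = d by [].
  by apply: (@face_inj_opp i (f i)); rewrite ?far ?d0 ?d1.
- have [|d Rd [d0 d1]] := cross (f i) _ _ h (rf _ Rc).
    by rewrite far face_reflect.
  suff -> : set_vertex (collapse i (f i) c) f y = d by [].
  by apply: (@face_inj_opp i (f i)); rewrite ?far ?d0 ?d1 // face_collapse face_reflect negbK.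
Qed.

Lemma set_vertex_const c f y : R c ->
  R (set_vertex c f y) <-> R (set_vertex (fun=> c f) f y).
Proof.
move=> Rc.
(* [cs s] is [c] collapsed towards [f] along the directions in [s]; once all directions are used,
   only the value [c f] is left. *)
pose cs (s : seq 'I_n) : cube 'I_n T :=
  fun g => c [ffun j => if j \in s then f j else g j].
have csS i s : cs (i :: s) = collapse i (f i) (cs s).
  apply/funext => g; rewrite /cs /collapse; congr c; apply/ffunP => j.
  by rewrite !ffunE inE; case: (j =P i) => [->|]; case: ifP.
have [_] : R (cs (enum 'I_n)) /\
    (R (set_vertex c f y) <-> R (set_vertex (cs (enum 'I_n)) f y)).
  elim: (enum _) => [|i s [Rs IH]].
    suff -> : cs [::] = c by [].
    by apply/funext => g; rewrite /cs; congr c; apply/ffunP => j; rewrite ffunE.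
  rewrite csS; split; first by have [cl _ _] := Rf i; apply: cl.
  by rewrite IH set_vertex_collapse.
suff -> : cs (enum 'I_n) = fun=> c f by [].
apply/funext => g; rewrite /cs; congr c; apply/ffunP => j.
by rewrite ffunE mem_enum.
Qed.

(** Reflecting in direction [i] moves the exceptional vertex across that direction, so it can be
    brought to [zero_vertex] one coordinate at a time. *)
Lemma corner_rel_vertex x f y :
  R (set_vertex (fun=> x) f y) <-> corner_rel R x y.
Proof.
have refl i g : R (set_vertex (fun=> x) g y) ->
    R (set_vertex (fun=> x) (set_coord g i (~~ g i)) y).
  move=> h; have [_ rf _] := Rf i.
  suff -> : set_vertex (fun=> x) (set_coord g i (~~ g i)) y
      = reflect_cube i (set_vertex (fun=> x) g y) by apply: rf.
  apply/funext => k; rewrite /reflect_cube /set_vertex; congr (if _ then _ else _).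
  apply/eqP/eqP => [->|<-]; apply/ffunP => j; rewrite !ffunE eqxx ?negbK;
    by case: eqP => [->|].
have coord i g e : R (set_vertex (fun=> x) g y) <->
    R (set_vertex (fun=> x) (set_coord g i e) y).
  have [->|->] : e = g i \/ e = ~~ g i by case: e (g i) => [] []; [left|right|right|left].
    suff -> : set_coord g i (g i) = g by [].
    by apply/ffunP => j; rewrite ffunE; case: eqP => [->|].
  split=> [|/(refl i)]; first exact: refl.
  suff -> : set_coord (set_coord g i (~~ g i)) i
      (~~ set_coord g i (~~ g i) i) = g by [].
  by apply/ffunP => j; rewrite !ffunE eqxx negbK; case: eqP => [->|].
pose fs (s : seq 'I_n) : {ffun 'I_n -> bool} :=
  [ffun j => if j \in s then false else f j].
have : R (set_vertex (fun=> x) f y) <->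
    R (set_vertex (fun=> x) (fs (enum 'I_n)) y).
  elim: (enum _) => [|i s ->].
    by suff -> : fs [::] = f by []; apply/ffunP => j; rewrite ffunE.
  suff -> : fs (i :: s) = set_coord (fs s) i false by apply: coord.
  by apply/ffunP => j; rewrite !ffunE inE; case: (j =P i).
suff -> : fs (enum 'I_n) = zero_vertex by [].
by apply/ffunP => j; rewrite !ffunE mem_enum.
Qed.

Lemma set_vertexE c f y : R c -> R (set_vertex c f y) <-> corner_rel R (c f) y.
Proof. by move=> Rc; rewrite set_vertex_const // corner_rel_vertex. Qed.

(** Vertices are changed one by one; every intermediate cube lies in [R], so [set_vertexE] permits
    the next change. *)
Lemma corner_rel_replace c d :
  R c -> (forall f, corner_rel R (c f) (d f)) -> R d.
Proof.
move=> Rc cd.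
pose ds (s : seq {ffun 'I_n -> bool}) : cube 'I_n T :=
  fun f => if f \in s then d f else c f.
suff : R (ds (enum {ffun 'I_n -> bool})).
  suff -> : ds (enum {ffun 'I_n -> bool}) = d by [].
  by apply/funext => f; rewrite /ds mem_enum.
elim: (enum _) => [|f s IH]; first by suff -> : ds [::] = c by [].
have dsS : ds (f :: s) = set_vertex (ds s) f (d f).
  by apply/funext => g; rewrite /ds /set_vertex inE; case: eqP => [->|].
(* The list in the induction may repeat a vertex, which then already carries its new value. *)
case fs: (f \in s).
  suff -> : ds (f :: s) = ds s by [].
  by rewrite dsS; apply/funext => g; rewrite /set_vertex /ds; case: eqP => [->|//]; rewrite fs.
by rewrite dsS set_vertexE // /ds fs.
Qed.

(** * The corner relation as the least equivalence with centrality *)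

Hypothesis Rconst : forall x, R (fun=> x).

Lemma corner_rel_equiv : Equivalence (corner_rel R).
Proof.
have refl x : corner_rel R x x.
  rewrite /corner_rel; suff -> : set_vertex (fun=> x) zero_vertex x = fun=> x by [].
  by apply/funext => f; rewrite /set_vertex; case: ifP.
split=> //.
(* Symmetry: in the constant cube [x], all vertices but [zero_vertex] are changed to [y]. *)
- move=> x y xy; apply: (corner_rel_replace (Rconst x)) => f.
  by rewrite /set_vertex; case: ifP.
- move=> x y z xy yz.
  have := set_vertexE zero_vertex z xy.
  have -> : set_vertex (fun=> x) zero_vertex y zero_vertex = y.
    by rewrite /set_vertex eqxx.
  move=> [_ /(_ yz)].
  rewrite /corner_rel; congr (R _); apply/funext => f.
  by rewrite /set_vertex; case: eqP.
Qed.

Lemma card_vertices_others i : #|{ffun others i -> bool}| = (2 ^ n.-1)%N.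
Proof.
by rewrite card_ffun card_bool card_sig; congr expn; rewrite cardC1 card_ord.
Qed.

(** If only the line at [g0] fails, replacing the upper end of every other line by its lower end
    stays in [R]. The result is the collapse of [c] changed at one vertex, so [set_vertexE] relates
    the ends of the line at [g0] too. *)
Lemma centrality_corner_rel i : centrality (corner_rel R) i R.
Proof.
move=> [c Rc]; set L := [set g | _]%SET => Lcard.
have : #|~: L| = 1.
  by rewrite cardsCs finset.setCK card_vertices_others Lcard subKn // expn_gt0.
move/eqP/cards1P => [g0 Lg0].
have Lg g : g != g0 -> corner_rel R (face i false c g) (face i true c g).
  move=> gg0; have : g \in L by rewrite -[L]finset.setCK Lg0 !inE.
  by rewrite inE => /asboolP.
have : g0 \in ~: L by rewrite Lg0 inE.
rewrite !inE => /asboolPn; apply.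
have [refl sym _] := corner_rel_equiv.
have [cl _ _] := Rf i.
have := set_vertexE (extend g0 true) (c (extend g0 true)) (cl false _ Rc).
rewrite {2}/collapse set_coord_extend => -[h _]; apply: h.
apply: (corner_rel_replace Rc) => f; rewrite -(extend_surj i f).
rewrite /set_vertex /collapse set_coord_extend; set g := [ffun _ => _].
case: eqP => [->|ne]; first exact: refl.
case: (f i) ne => [ne|_]; last exact: refl.
by apply: sym; apply: Lg; apply: contra_notN ne => /eqP ->.
Qed.

(** In the corner cube, all [i]-lines are [(x, x)] except the one through [zero_vertex], which is
    [(y, x)]. If [delta] omitted [(x, y)], exactly one line would fail. *)
Lemma corner_rel_sub i (delta : T -> T -> Prop) x y :
  Equivalence delta -> centrality delta i R -> corner_rel R x y -> delta x y.
Proof.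
move=> [refl sym _] cent xy; apply: contrapT => ndelta; apply: cent.
exists (set_vertex (fun=> x) zero_vertex y) => //.
pose g0 : {ffun others i -> bool} := [ffun=> false].
have line0 : extend g0 false = zero_vertex.
  by apply/ffunP => j; rewrite !ffunE; case: insubP => // k; rewrite ffunE.
have notzero g e : (g != g0) || e -> (extend g e == zero_vertex) = false.
  move=> h; apply/eqP => gE; move: h; case: e gE => gE /=.
    by have := extend_at g true; rewrite gE ffunE.
  by rewrite -(extendK g false) -(extendK g0 false) gE line0 eqxx.
rewrite -(card_vertices_others i) subn1 -(cardsC1 g0); apply: eq_card => g.
rewrite !inE /face /set_vertex (@notzero g true) ?orbT //.
case: (g =P g0) => [->|/eqP gg0] /=.
  by rewrite line0 eqxx; apply/asboolP => /sym.
by rewrite notzero ?gg0 //; apply/asboolP.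
Qed.

End FaceClosed.
End Cubes.

(** * The hypercommutator as a corner relation *)

Lemma Delta_const (A : algebra) n (theta : 'I_n.+1 -> A -> A -> Prop) x :
  (forall i, Reflexive (theta i)) -> Delta theta (fun=> x).
Proof.
move=> refl R [_]; apply; exists ord0, x, x; split; first exact: refl.
by apply/funext => f; rewrite /cube_at; case: ifP.
Qed.

Lemma hypercommutator_corner_rel (A : algebra) n
    (theta : 'I_n.+1 -> A -> A -> Prop) :
  (forall i, Reflexive (theta i)) ->
  hypercommutator theta = corner_rel (Delta theta).
Proof.
move=> refl; have [Rcomp /face_closedP Rf] := hdcongruence_Delta theta.
have Rconst x := Delta_const x refl.
apply/funext => x; apply/funext => y; apply/propext; split; last first.
  by move=> xy delta [deltaE _] cent; apply: corner_rel_sub cent xy.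
apply; last exact: centrality_corner_rel.
split; first exact: corner_rel_equiv.
(* Operations act vertexwise, so they send corner cubes to a corner cube. *)
move=> s u v uv; have := Rcomp s _ uv; rewrite /corner_rel.
congr (Delta theta _); apply/funext => f.
by rewrite /set_vertex; case: ifP.
Qed.

(** * Permuting the coordinates *)

Section Relabel.
Variables (A : algebra) (n : nat) (s : {perm 'I_n}).

Definition relabel_vertex (f : {ffun 'I_n -> bool}) : {ffun 'I_n -> bool} :=
  [ffun j => f (s j)].

(** Direction [i] of [c] becomes direction [s i] of [relabel c]. *)
Definition relabel (c : cube 'I_n A) : cube 'I_n A := c \o relabel_vertex.

Lemma relabel_set_coord f i e :
  relabel_vertex (set_coord f (s i) e) = set_coord (relabel_vertex f) i e.
Proof. by apply/ffunP => j; rewrite !ffunE (inj_eq perm_inj). Qed.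

Lemma face_closed_relabel (R : set (cube 'I_n A)) :
  face_closed R -> face_closed [set c | R (relabel c)].
Proof.
move=> Rf i; have [cl rf gl] := Rf (s i); split=> /=.
- move=> e c /(cl e); congr (R _); apply/funext => f.
  by rewrite /relabel /collapse /= relabel_set_coord.
- move=> c /rf; congr (R _); apply/funext => f.
  by rewrite /relabel /reflect_cube /= relabel_set_coord ffunE.
- move=> c d Rc Rd cd.
  have -> : relabel (glue i c d) = glue (s i) (relabel c) (relabel d).
    by apply/funext => f; rewrite /relabel /glue /= ffunE.
  apply: gl => //; apply/funext => g; rewrite /face /relabel /=.
  (* The coordinates other than [i] do not depend on [e]; the [true] on the right is an arbitrary
     choice. *)
  have ext e : relabel_vertex (extend g e) =
      extend [ffun j : others i => relabel_vertex (extend g true) (val j)] e.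
    rewrite -[LHS](extend_surj i) ffunE extend_at; congr (extend _ e).
    apply/ffunP => j; rewrite !ffunE; case: insubP => // /negP [].
    by rewrite (inj_eq perm_inj) (valP j).
  by rewrite [in LHS]ext [in RHS]ext; apply: (congr1 (@^~ _) cd).
Qed.

(** By minimality: the preimage of [Delta theta] under [relabel] is a higher dimensional congruence,
    and [relabel] sends [cube_at i x y] to [cube_at (s i) x y]. *)
Lemma Delta_relabel (theta : 'I_n -> A -> A -> Prop) c :
  Delta (fun i => theta (s i)) c -> Delta theta (relabel c).
Proof.
have [Rcomp /face_closedP Rf] := hdcongruence_Delta theta.
apply: (_ : smallest _ _ `<=` [set d | Delta theta (relabel d)]).
apply: smallest_sub.
  split; first by move=> t d dR; apply: (Rcomp t (fun k => relabel (d k))).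
  exact/face_closedP/face_closed_relabel.
move=> _ [i [x [y [xy ->]]]] R [_]; apply; exists (s i), x, y; split=> //.
by apply/funext => f; rewrite /relabel /cube_at /= ffunE.
Qed.

(** [zero_vertex] is invariant under permuting coordinates, so [relabel] fixes the corner cubes. *)
Lemma corner_rel_relabel (theta : 'I_n -> A -> A -> Prop) x y :
  corner_rel (Delta (fun i => theta (s i))) x y -> corner_rel (Delta theta) x y.
Proof.
move/Delta_relabel; rewrite /corner_rel; congr (Delta theta).
apply/funext => f; rewrite /relabel /set_vertex /=; congr (if _ then _ else _).
apply/eqP/eqP => [fE|->]; apply/ffunP => j; last by rewrite !ffunE.
have := congr1 (fun h : {ffun _} => h ((s^-1)%g j)) fE.
by rewrite !ffunE permKV.
Qed.

End Relabel.

Theorem corollary4p11 (A : algebra) (n : nat) (hn : (2 <= n.+1)%N)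
    (theta : 'I_n.+1 -> A -> A -> Prop)
    (htheta : forall i : 'I_n.+1, congruence (theta i))
    (sigma : {perm 'I_n.+1}) :
  hypercommutator theta = hypercommutator (fun i : 'I_n.+1 => theta (sigma i)).
Proof.
have refl i : Reflexive (theta i) by have [[]] := htheta i.
rewrite !hypercommutator_corner_rel //.
apply/funext => x; apply/funext => y; apply/propext; split; last first.
  exact: corner_rel_relabel.
(* The other inclusion is the same lemma for the permuted family, which [sigma^-1] turns back into
   [theta]. *)
move=> xy; apply: (@corner_rel_relabel _ _ (sigma^-1)%g).
suff -> : (fun i => theta (sigma ((sigma^-1)%g i))) = theta by [].
by apply/funext => i; rewrite permKV.
Qed.
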